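(* Let $m\leq n$ be positive integers, let $\alpha^{\ast}$ be the unique real solution to the equation $1=\alpha(1+\alpha)^{2}$ and let $\beta^{\ast}=\sqrt{\alpha^{\ast}}$. Then (a) if $f\in\mathcal{W}_{n}$ and $g\in\mathcal{W}_{m}^{\alpha^{\ast}}$, then $f\bullet g\subset\mathcal{W}_{m}^{\alpha^{\ast}}$; (b) if $f\in\mathcal{W}_{n}^{\beta^{\ast}}$ and $g\in\mathcal{W}_{m}^{\beta^{\ast}}$, then $f\bullet g\subset\mathcal{W}_{m}^{\alpha^{\ast}}$.
   Context: For an integer $k\ge 0$, $\mathbb{R}_k^+$ denotes the set of real polynomials $s\mapsto c_0+c_1s+\ldots+c_ks^k$ with all $c_i>0$ ($i=0,\ldots,k$). For $k\ge 1$, $\mathcal{H}_k$ is the set of $f\in\mathbb{R}_k^+$ all of whose complex zeros have negative real part (Hurwitz stable polynomials). For $k\ge 3$ and $f(s)=a_0+a_1s+\ldots+a_ks^k\in\mathbb{R}_k^+$ put $\lambda_i(f)=\dfrac{a_{i-2}a_{i+1}}{a_ia_{i-1}}$ for $i=2,\ldots,k-1$. For $k\ge3$ and $\alpha\in\mathbb{R}$ let $\mathcal{W}_k=\{f\in\mathbb{R}_k^+:\lambda_i(f)<1\ (i=2,\ldots,k-1)\}$ and $\mathcal{W}_k^{\alpha}=\{f\in\mathbb{R}_k^+:\lambda_i(f)<\alpha\ (i=2,\ldots,k-1)\}$. By definition, for $k=1,2$, $\mathcal{W}_k=\mathcal{H}_k$ and $\mathcal{W}_k^{\alpha}=\mathcal{H}_k$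 for every $\alpha\in(0,1)$. (Numerically $\alpha^*\approx 0.46557$, $\beta^*\approx 0.68233$.) For $f(s)=\sum_{i=0}^n a_is^i\in\mathbb{R}_n^+$ and $g(s)=\sum_{i=0}^m b_is^i\in\mathbb{R}_m^+$ with $m\le n$, the generalized Hadamard product of $f$ and $g$ is the set $f\bullet g=\{F_0,\ldots,F_{n-m}\}$, where $F_j(s)=\sum_{i=0}^m a_{j+i}b_is^i$ for $j=0,\ldots,n-m$. *)

(* Defs.v *)
From HB Require Import structures.
From mathcomp Require Import all_boot all_order all_algebra.
From mathcomp Require Import complex.
From mathcomp Require Import boolp classical_sets reals.

Set Implicit Arguments.
Unset Strict Implicit.
Unset Printing Implicit Defensive.

Import Order.TTheory GRing.Theory Num.Theory.

Local Open Scope classical_set_scope.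
Local Open Scope ring_scope.

Section Defs.
Context {R : realType}.
Implicit Types (f g : {poly R}) (i j k m n : nat) (alpha : R).

(* Real polynomials of degree exactly k with positive coefficients. *)
Definition pos_poly k : set {poly R} :=
  [set f | size f = k.+1 /\ forall i, (i <= k)%N -> 0 < f`_i].

Definition hurwitz k : set {poly R} :=
  [set f | pos_poly k f /\
           forall z : R[i], root (map_poly (real_complex R) f) z ->
                            complex.Re z < 0].

(* Only meaningful for i >= 2, because of the truncated subtractions. *)
Definition lambda i f : R :=
  (f`_(i - 2) * f`_(i + 1)) / (f`_i * f`_(i - 1)).

(* The degrees 1 and 2 are special by convention, the index range
   2 <= i <= k - 1 being empty; there alpha is only relevant in ]0, 1[.
   The value at k = 0 is junk. *)
Definition W_alpha k alpha : set {poly R} :=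
  if (3 <= k)%N then
    [set f | pos_poly k f /\
             forall i, (2 <= i <= k - 1)%N -> lambda i f < alpha]
  else hurwitz k.

Definition W k : set {poly R} :=
  if (3 <= k)%N then
    [set f | pos_poly k f /\ forall i, (2 <= i <= k - 1)%N -> lambda i f < 1]
  else hurwitz k.

Definition hadamard_shift m j f g : {poly R} :=
  \poly_(i < m.+1) (f`_(j + i) * g`_i).

(* For f of degree n and g of degree m <= n. *)
Definition gen_hadamard n m f g : set {poly R} :=
  [set F | exists2 j, (j <= n - m)%N & F = hadamard_shift m j f g].

End Defs.

(* Main.v *)
(** For F = F_j in f • g one has lambda_i(F) = lambda_{j+i}(f) lambda_i(g), so
    bounds a and b on the lambda's of f and g give the bound a b for F; then
    alpha = 1 * alpha = beta ^ 2. In degrees 1 and 2 every polynomial with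
    positive coefficients is Hurwitz: if x + iy is a zero with x >= 0, the
    imaginary part y (c_1 + 2 c_2 x) = 0 forces y = 0, and then the real part
    c_0 + c_1 x + c_2 x ^ 2 is positive. *)
Require Import Defs.
From HB Require Import structures.
From mathcomp Require Import all_boot all_order all_algebra.
From mathcomp Require Import complex.
From mathcomp Require Import boolp classical_sets reals.
From mathcomp Require Import ring lra zify.

Set Implicit Arguments.
Unset Strict Implicit.
Unset Printing Implicit Defensive.

Import Order.TTheory GRing.Theory Num.Theory.

Local Open Scope classical_set_scope.
Local Open Scope ring_scope.

Lemma cubic_root_gt0 (R : realType) (a : R) : 1 = a * (1 + a) ^+ 2 -> 0 < a.
Proof.
move=> ha; rewrite ltNge; apply/negP => a_le0.
have := mulr_le0_ge0 a_le0 (sqr_ge0 (1 + a)).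
by rewrite -ha ler10.
Qed.

(** Existence is the intermediate value theorem on [0, 1], where [p] goes from -1 to 3; for
    uniqueness, the difference of two values is factored by x - y. *)
Lemma cubic_root_unique (R : realType) :
  exists! a : R, 1 = a * (1 + a) ^+ 2.
Proof.
pose p : {poly R} := 'X * (1 + 'X) ^+ 2 - 1.
have pE x : p.[x] = x * (1 + x) ^+ 2 - 1 by rewrite /p !hornerE.
have [|x _ /rootP px] := @poly_ivt R p 0 1 ler01.
  by rewrite !pE; apply/andP; split; lra.
exists x; split=> [|y hy].
  by apply/eqP; rewrite eq_sym -subr_eq0 -pE px.
have hx : 1 = x * (1 + x) ^+ 2 by apply/eqP; rewrite eq_sym -subr_eq0 -pE px.
have x_gt0 := cubic_root_gt0 hx; have y_gt0 := cubic_root_gt0 hy.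
have : (x - y) * ((1 + x + y) ^+ 2 - x * y) = 0.
  rewrite [LHS](_ : _ = x * (1 + x) ^+ 2 - y * (1 + y) ^+ 2); last by ring.
  by rewrite -hx -hy subrr.
move/eqP; rewrite mulf_eq0 subr_eq0 => /orP[/eqP //|/eqP h0].
(* The cofactor expands to 1 + 2x + 2y + x^2 + xy + y^2, which is positive for x, y > 0. *)
have : 0 < x * y by rewrite mulr_gt0.
by nra.
Qed.

Lemma pos_poly_hurwitz (R : realType) (k : nat) (f : {poly R}) :
  (0 < k <= 2)%N -> pos_poly k f -> hurwitz k f.
Proof.
move=> /andP[k_gt0 k_le2] [sf f_gt0]; split=> // -[x y] /rootP.
set c := fun i => f`_i.
(* In degree 1 this coefficient is the default 0, so both degrees are treated as a quadratic with
   [c 2] possibly zero. *)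
have f2 : 0 <= c 2%N.
  case: (leqP 2 k) => [/f_gt0/ltW //|k_lt2].
  by rewrite /c nth_default // sf.
have f0 : 0 < c 0%N by apply: f_gt0.
have f1 : 0 < c 1%N by apply: f_gt0.
have {}sf : (size (map_poly (real_complex R) f) <= 3)%N.
  by rewrite size_map_poly sf ltnS.
rewrite (horner_coef_wide _ sf) !big_ord_recl big_ord0 !coef_map /=.
rewrite expr0 expr1 expr2 -/(c 0%N) -/(c 1%N) -/(c 2%N).
move/eqP; rewrite eq_complex /= => /andP[/eqP re0 /eqP im0].
rewrite ltNge; apply/negP => x_ge0.
have /eqP : y * (c 1%N + 2 * c 2%N * x) = 0 by rewrite -im0; ring.
have c2x := mulr_ge0 f2 x_ge0.
rewrite mulf_eq0 => /orP[/eqP y0|/eqP]; last by lra.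
have := mulr_ge0 c2x x_ge0; have := mulr_ge0 (ltW f1) x_ge0.
by move: re0; rewrite y0; nra.
Qed.

Lemma W_alpha_pos_poly (R : realType) (k : nat) (a : R) (f : {poly R}) :
  W_alpha k a f -> pos_poly k f.
Proof. by rewrite /W_alpha; case: ifP => _ []. Qed.

(** Makes part (a) an instance of the product bound, with first factor 1. *)
Lemma W_alpha1 (R : realType) (k : nat) : W k = W_alpha k 1 :> set {poly R}.
Proof. by []. Qed.

Lemma coef_hadamard_shift (R : realType) (m j i : nat) (f g : {poly R}) :
  (i <= m)%N -> (hadamard_shift m j f g)`_i = f`_(j + i) * g`_i.
Proof. by move=> im; rewrite coef_poly ltnS im. Qed.

Lemma hadamard_shift_pos_poly (R : realType) (m n j : nat) (f g : {poly R}) :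
  (m <= n)%N -> (j <= n - m)%N -> pos_poly n f -> pos_poly m g ->
  pos_poly m (hadamard_shift m j f g).
Proof.
move=> mn jnm [_ f_gt0] [_ g_gt0].
have F_gt0 i : (i <= m)%N -> 0 < f`_(j + i) * g`_i.
  by move=> im; rewrite mulr_gt0 ?g_gt0 // f_gt0 //; lia.
split=> [|i im]; last by rewrite coef_hadamard_shift ?F_gt0.
(* The size is exactly m + 1 because the top coefficient is nonzero. *)
by rewrite size_poly_eq // gt_eqF ?F_gt0.
Qed.

Lemma lambda_hadamard_shift (R : realType) (m j i : nat) (f g : {poly R}) :
  (2 <= i <= m - 1)%N ->
  lambda i (hadamard_shift m j f g) = lambda (j + i) f * lambda i g.
Proof.
move=> /andP[i2 im]; rewrite /lambda !coef_hadamard_shift; try lia.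
(* Since i >= 2, truncated subtraction commutes with the shift: (j + i) - 2 = j + (i - 2). *)
rewrite -!addnBA -?addnA; try lia.
by rewrite [LHS](_ : _ = (f`_(j + (i - 2)) * f`_(j + (i + 1)) *
  (g`_(i - 2) * g`_(i + 1))) / ((f`_(j + i) * f`_(j + (i - 1))) *
  (g`_i * g`_(i - 1)))) ?mulf_div //; congr (_ / _); ring.
Qed.

(** Nonnegativity is what allows two strict upper bounds to be multiplied. *)
Lemma lambda_ge0 (R : realType) (k i : nat) (f : {poly R}) :
  pos_poly k f -> (2 <= i <= k - 1)%N -> 0 <= lambda i f.
Proof.
move=> [_ f_gt0] /andP[i2 ik].
by rewrite /lambda divr_ge0 ?mulr_ge0 // ltW // f_gt0 //; lia.
Qed.

Lemma gen_hadamard_W_alpha (R : realType) (m n : nat) (a b : R)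
    (f g : {poly R}) :
  (0 < m)%N -> (m <= n)%N -> W_alpha n a f -> W_alpha m b g ->
  gen_hadamard n m f g `<=` W_alpha m (a * b).
Proof.
move=> m_gt0 mn fW gW F [j jnm ->].
have f_pos := W_alpha_pos_poly fW; have g_pos := W_alpha_pos_poly gW.
have F_pos := hadamard_shift_pos_poly mn jnm f_pos g_pos.
move: fW gW; rewrite /W_alpha; case: (leqP 3 m) => [m3|m3 _ _]; last first.
  (* For m <= 2 the target is [hurwitz m], whatever the value of n. *)
  by apply: pos_poly_hurwitz => //; rewrite m_gt0.
rewrite (leq_trans m3 mn) => -[_ fa] [_ gb]; split=> // i im.
have jin : (2 <= j + i <= n - 1)%N by lia.
rewrite lambda_hadamard_shift //.
by rewrite ltr_pM ?fa ?gb ?(lambda_ge0 f_pos) ?(lambda_ge0 g_pos).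
Qed.

Theorem theorem5 (R : realType) (m n : nat) (hm : (0 < m)%N) (hmn : (m <= n)%N) :
  (exists! a : R, 1 = a * (1 + a) ^+ 2) /\
  forall alpha beta : R,
    1 = alpha * (1 + alpha) ^+ 2 ->
    beta = Num.sqrt alpha ->
    (forall f g : {poly R}, W n f -> W_alpha m alpha g ->
       gen_hadamard n m f g `<=` W_alpha m alpha) /\
    (forall f g : {poly R}, W_alpha n beta f -> W_alpha m beta g ->
       gen_hadamard n m f g `<=` W_alpha m alpha).
Proof.
split=> [|alpha beta h_alpha ->]; first exact: cubic_root_unique.
split=> f g.
  by rewrite W_alpha1 -{2}(mul1r alpha); exact: gen_hadamard_W_alpha.
(* Only the [alpha] of the target becomes a product of two square roots; this needs alpha >= 0. *)
rewrite -{3}(sqr_sqrtr (ltW (cubic_root_gt0 h_alpha))) expr2.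
exact: gen_hadamard_W_alpha.
Qed.
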